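(* Let $\hat H$ be a locally interacting Hamiltonian with a unique (non-degenerate) ground state $|G\rangle$ of energy $E_0$ and spectral gap $\Delta>0$, and let $v$ be its Lieb–Robinson velocity. Let $\hat A_X,\hat B_Y$ be arbitrary local observables with $\|\hat A_X\|=\|\hat B_Y\|=1$, supported on non-overlapping regions $X,Y$ at distance $d_{XY}$. Let $\bar P_G=\hat{\mathds 1}-|G\rangle\langle G|$ and $$f_{XY}\equiv\langle G|\hat A_X\frac{\bar P_G}{E_0-\hat H}\hat B_Y|G\rangle+\mathrm{c.c.}$$ Then $$|f_{XY}|\le C\sqrt{d_{XY}}\,e^{-d_{XY}/\xi},\qquad \xi^{-1}=\begin{cases}\dfrac{\Delta}{2v}&\text{if }\Delta\le v,\\[2mm]\dfrac12W\!\left(\dfrac{\Delta^2e}{v^2}\right)&\text{if }\Delta>v,\end{cases}$$ where $W$ is the Lambert-$W$ function and $C$ is a constant depending on $\hat A_X$ and $\hat B_Y$ (but not on $d_{XY}$).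
   Context: ''Locally interacting'' means $\hat H$ is a sum of bounded terms each acting on a bounded number of neighbouring lattice sites, with finite local Hilbert space. The Lieb–Robinson velocity $v$ is the velocity in a Lieb–Robinson bound for $\hat H$, i.e. a bound on $\|[\hat A_X(t),\hat B_Y]\|$ with $\hat A_X(t)=e^{i\hat Ht}\hat A_Xe^{-i\hat Ht}$ of the form $C'(v|t|/d_{XY})^{d_{XY}+1}$ for $v|t|\le d_{XY}$ (and by $2$ trivially otherwise). $\frac{\bar P_G}{E_0-\hat H}$ denotes the reduced resolvent (inverse of $E_0-\hat H$ on the range of $\bar P_G$, zero on $|G\rangle$). *)

(* Defs.v *)
From HB Require Import structures.
From mathcomp Require Import all_boot all_order all_algebra.
From mathcomp Require Import complex.
From mathcomp Require Import all_classical all_reals all_analysis.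
Set Implicit Arguments. Unset Strict Implicit. Unset Printing Implicit Defensive.
Import Order.TTheory GRing.Theory Num.Theory.
Local Open Scope ring_scope.
Local Open Scope complex_scope.

Section QDefs.
Variable R : realType.
Local Notation C := R[i].

Definition mxadj (m n : nat) (M : 'M[C]_(m, n)) : 'M[C]_(n, m) :=
  (map_mx (@conjc R) M)^T.

Definition unitary_mx (n : nat) (U : 'M[C]_n) : Prop := U *m mxadj U = 1%:M.
Definition hermitian_mx (n : nat) (M : 'M[C]_n) : Prop := mxadj M = M.

Definition cexpi (th : R) : C := (cos th) +i* (sin th).

Definition fcalc (n : nat) (U : 'M[C]_n) (g : 'I_n -> C) : 'M[C]_n :=
  U *m diag_mx (\row_k g k) *m mxadj U.

Definition cabs (z : C) : R :=
  Num.sqrt ((complex.Re z) ^+ 2 + (complex.Im z) ^+ 2).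

Definition vnorm (n : nat) (x : 'cV[C]_n) : R :=
  Num.sqrt (\sum_i ((complex.Re (x i 0)) ^+ 2 + (complex.Im (x i 0)) ^+ 2)).

Definition opnorm (n : nat) (M : 'M[C]_n) : R :=
  sup [set r : R | exists x : 'cV[C]_n, vnorm x <= 1 /\ r = vnorm (M *m x)].

(* Heisenberg evolution A(t) = e^{iHt} A e^{-iHt}, with H = U diag(E) U^dagger *)
Definition heis (n : nat) (U : 'M[C]_n) (E : 'I_n -> R) (t : R) (A : 'M[C]_n)
  : 'M[C]_n :=
  fcalc U (fun k => cexpi (E k * t)) *m A *m fcalc U (fun k => cexpi (- (E k * t))).

Definition commut (n : nat) (A B : 'M[C]_n) : 'M[C]_n := A *m B - B *m A.

Definition expect (n : nat) (psi : 'cV[C]_n) (M : 'M[C]_n) : C :=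
  (mxadj psi *m M *m psi) 0 0.

(* reduced resolvent  Pbar_G / (E0 - H): inverse of E0 - H on the range of Pbar_G,
   zero on |G> = U e_0, for H = U diag(E) U^dagger with E0 = E 0 *)
Definition red_resolvent (n : nat) (U : 'M[C]_n.+1) (E : 'I_n.+1 -> R) : 'M[C]_n.+1 :=
  fcalc U (fun k => if k == ord0 then 0 else ((E ord0 - E k)^-1)%:C).

Definition fXY (n : nat) (U : 'M[C]_n.+1) (E : 'I_n.+1 -> R) (A B : 'M[C]_n.+1) : C :=
  let z := expect (col ord0 U) (A *m red_resolvent U E *m B) in z + z^*.

(* principal branch of the Lambert W function on [0, +oo):
   the w >= 0 with w e^w = x *)
Definition lambertW (x : R) : R :=
  sup [set w : R | 0 <= w /\ w * expR w <= x].

Definition xi_inv (Delta v : R) : R :=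
  if Delta <= v then Delta / (2 * v)
  else lambertW (Delta ^+ 2 * expR 1 / v ^+ 2) / 2.

End QDefs.

(* Main.v *)
Require Import Defs.
From HB Require Import structures.
From mathcomp Require Import all_boot all_order all_algebra.
From mathcomp Require Import complex ring lra.
From mathcomp Require Import all_classical all_reals all_analysis.
Set Implicit Arguments. Unset Strict Implicit. Unset Printing Implicit Defensive.
Import Order.TTheory GRing.Theory Num.Theory.
Import numFieldNormedType.Exports.
Local Open Scope ring_scope.
Local Open Scope complex_scope.

(** With [c_k = <0|A|k><k|B|0>], [x_k = Re c_k] and [w_k = E_k - E_0 >= Delta],
    one has [f_XY = - 2 \sum_k x_k / w_k], while the part of the ground state
    expectation of [[A(t), B]] that is odd in [t] is proportional to
    [S(t) = \sum_k x_k sin (w_k t)], which the Lieb-Robinson bound controls up to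
    the time [T = d / v]. Let [P(t) = \sum_k x_k (1 - cos (w_k t)) / w_k] be the
    primitive of [S]. Averaging [\sum_k x_k / w_k = P(t) + \sum_k x_k cos (w_k t) / w_k]
    over [[0, T]] with the weight [exp (- a t^2)], the first term is small by the
    Lieb-Robinson bound and the second one because the truncated Gaussian cosine
    integral is at most of order [exp (- w^2 / 4a) + exp (- a T^2)]. With
    [a = y v^2 / 2d], the choice of [y] that balances the errors yields the rate
    [xi_inv]; the length of the time interval divided by the width of the Gaussian
    yields the factor [sqrt d]. *)

(** * The Gaussian time filter *)

Section gaussian_filter.
Local Open Scope classical_set_scope.
Variable R : realType.
Implicit Types (f g F df dg : R -> R) (a b w t T tau : R).
Notation mu := (@lebesgue_measure R).

Lemma is_derive_continuous f df :
  (forall t, is_derive t 1 f (df t)) -> continuous f.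
Proof.
move=> fdf t; apply: differentiable_continuous; apply/derivable1_diffP.
by have [] := fdf t.
Qed.

Lemma continuous_integrable_itv f a b :
  continuous f -> mu.-integrable `[a, b] (EFin \o f).
Proof.
move=> cf; apply: continuous_compact_integrable; first exact: segment_compact.
exact: continuous_subspaceT.
Qed.

(** Both [g - f] and [g + f] have nonnegative derivative on [[a, b]], so by the mean value theorem
    neither can decrease. *)
Lemma normB_le_derive f g df dg a b : a <= b ->
  (forall t, is_derive t 1 f (df t)) -> (forall t, is_derive t 1 g (dg t)) ->
  (forall t, a <= t <= b -> `|df t| <= dg t) ->
  `|f b - f a| <= g b - g a.
Proof.
move=> ab fdf gdg le_df_dg.
have key (h dh : R -> R) : (forall t, is_derive t 1 h (dh t)) ->
    (forall t, a <= t <= b -> 0 <= dh t) -> 0 <= h b - h a.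
  move=> hdh dh0.
  have [c] := MVT_segment ab (fun t _ => hdh t)
    (continuous_subspaceT (is_derive_continuous hdh)).
  by rewrite in_itv => /= cab ->; rewrite mulr_ge0 ?dh0 ?subr_ge0.
have gf := key _ _ (fun t => is_deriveB (gdg t) (fdf t)).
have gNf := key _ _ (fun t => is_deriveD (gdg t) (fdf t)).
rewrite ler_norml; apply/andP; split.
- have := gNf _; rewrite !fctE; suff h : forall t, a <= t <= b -> 0 <= dg t + df t.
    by move=> /(_ h); lra.
  by move=> t /le_df_dg; rewrite ler_norml => /andP[]; lra.
- have := gf _; rewrite !fctE; suff h : forall t, a <= t <= b -> 0 <= dg t - df t.
    by move=> /(_ h); lra.
  by move=> t /le_df_dg; rewrite ler_norml => /andP[]; lra.
Qed.

Lemma Rintegral_is_derive f F a b : a < b -> continuous f ->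
  (forall t, is_derive t 1 F (f t)) ->
  \int[mu]_(t in `[a, b]) f t = F b - F a.
Proof.
move=> ab cf Ff; rewrite /Rintegral (@continuous_FTC2 _ f F a b) //.
- exact: continuous_subspaceT.
- split; first by move=> t _; have [] := Ff t.
    exact/cvg_at_right_filter/(is_derive_continuous Ff).
  exact/cvg_at_left_filter/(is_derive_continuous Ff).
- by move=> t _; rewrite derive1E; have [] := Ff t.
Qed.

Lemma Rintegral_bigsum (I : Type) (r : seq I) (f : I -> R -> R) a b :
  (forall i, continuous (f i)) ->
  \int[mu]_(t in `[a, b]) (\sum_(i <- r) f i t) =
  \sum_(i <- r) \int[mu]_(t in `[a, b]) f i t.
Proof.
move=> cf; elim: r => [|i r IH].
  rewrite big_nil; under eq_Rintegral do rewrite big_nil.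
  by rewrite Rintegral_cst// mul0r.
rewrite big_cons -IH -RintegralD//; first last.
- apply: continuous_integrable_itv => t.
  by apply: cvg_big => //; [exact: add_continuous|move=> j _; exact: cf].
- exact: continuous_integrable_itv.
by apply: eq_Rintegral => t _; rewrite big_cons.
Qed.

(** Truncated Gaussian cosine transform; its value at [w = 0] is the total weight of the average
    over [[0, T]]. *)
Definition gauss_cos a T w : R :=
  \int[mu]_(t in `[0, T]) (expR (- (a * t ^+ 2)) * cos (w * t)).

Lemma continuous_gauss_cos a w :
  continuous (fun t : R => expR (- (a * t ^+ 2)) * cos (w * t)).
Proof. by apply: is_derive_continuous. Qed.

Lemma continuous_gauss_sin a w :
  continuous (fun t : R => t * expR (- (a * t ^+ 2)) * sin (w * t)).
Proof. by apply: is_derive_continuous. Qed.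

Lemma is_derive_gauss_cos a T w : 0 <= a ->
  is_derive w 1 (gauss_cos a T)
    (- \int[mu]_(t in `[0, T]) (t * expR (- (a * t ^+ 2)) * sin (w * t))).
Proof.
move=> a0.
pose f w t := expR (- (a * t ^+ 2)) * cos (w * t).
have df (x y : R) : is_derive x 1 (f ^~ y) (- (y * expR (- (a * y ^+ 2)) * sin (x * y))).
  apply: is_derive_eq; rewrite /= ?scaler0 ?addr0 ?add0r /GRing.scale /=; ring.
have d1f (x y : R) : partial1of2 f x y = - (y * expR (- (a * y ^+ 2)) * sin (x * y)).
  by rewrite partial1of2E; have [] := df x y.
have Iw : (`]w - 1, w + 1[ : set R) w by rewrite /= in_itv /=; lra.
have intf (x : R) : (`]w - 1, w + 1[ : set R) x -> mu.-integrable `[0, T] (EFin \o f x).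
  by move=> _; apply: continuous_integrable_itv; exact: continuous_gauss_cos.
have derf (x y : R) : (`]w - 1, w + 1[ : set R) x -> (`[0, T] : set R) y ->
    derivable (f ^~ y) x 1 by move=> _ _; have [] := df x y.
(* The exponential and the sine are at most 1 in absolute value, so [|y|] dominates the derivative
   uniformly in the frequency. *)
have intG : mu.-integrable `[0, T] (EFin \o (fun y : R => `|y|)).
  by apply: continuous_integrable_itv; exact: norm_continuous.
have G_ub (x y : R) : (`]w - 1, w + 1[ : set R) x -> (`[0, T] : set R) y ->
    `|partial1of2 f x y| <= `|y|.
  move=> _ _; rewrite d1f normrN !normrM -mulrA ler_piMr//.
  rewrite mulr_ile1//.
    by rewrite (gtr0_norm (expR_gt0 _)) -expR0 ler_expR oppr_le0 mulr_ge0 ?sqr_ge0.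
  by rewrite ler_norml sin_geN1 sin_le1.
apply: DeriveDef.
  exact: (derivable_under_integral _ Iw intf derf _ intG G_ub).
rewrite -derive1E (differentiation_under_integral _ Iw intf derf _ intG G_ub)//.
rewrite -[RHS]mulN1r -RintegralZl//; last first.
  by apply: continuous_integrable_itv; exact: continuous_gauss_sin.
by apply: eq_Rintegral => y _; rewrite d1f mulN1r.
Qed.

(** Integrates the derivative of [expR (- (a * t ^+ 2)) * sin (w * t)]. With [is_derive_gauss_cos]
    it yields the differential equation in [w] behind [gauss_cos_le]. *)
Lemma gauss_cos_by_parts a T w : 0 < T ->
  2 * a * \int[mu]_(t in `[0, T]) (t * expR (- (a * t ^+ 2)) * sin (w * t)) =
  w * gauss_cos a T w - expR (- (a * T ^+ 2)) * sin (w * T).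
Proof.
move=> T0.
pose g t := w * (expR (- (a * t ^+ 2)) * cos (w * t)) -
  2 * a * (t * expR (- (a * t ^+ 2)) * sin (w * t)).
pose F t := expR (- (a * t ^+ 2)) * sin (w * t).
have dF (t : R) : is_derive t 1 F (g t).
  apply: is_derive_eq; rewrite /= ?scaler0 ?addr0 ?add0r /GRing.scale /= /g; ring.
have cg : continuous g.
  move=> t; apply: cvgB; apply: cvgM; try exact: cvg_cst.
    exact: continuous_gauss_cos.
  exact: continuous_gauss_sin.
have := Rintegral_is_derive T0 cg dF.
rewrite {2}/F mulr0 sin0 mulr0 subr0.
have ic := continuous_integrable_itv 0 T (@continuous_gauss_cos a w).
have ins := continuous_integrable_itv 0 T (@continuous_gauss_sin a w).
rewrite /g RintegralB//; last 2 first.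
- apply: continuous_integrable_itv => t.
  by apply: cvgM; [exact: cvg_cst|exact: continuous_gauss_cos].
- apply: continuous_integrable_itv => t.
  by apply: cvgM; [exact: cvg_cst|exact: continuous_gauss_sin].
rewrite !RintegralZl//.
rewrite -/(gauss_cos a T w) /F; lra.
Qed.

Lemma gauss_cos_ge0 a T : 0 <= gauss_cos a T 0.
Proof.
by apply: Rintegral_ge0 => t _; rewrite mul0r cos0 mulr1 expR_ge0.
Qed.

(* [phi := gauss_cos a T] solves [phi' = - w phi / 2a + boundary term at T], so
   [exp (w^2 / 4a) * phi] varies only through the boundary term. *)
Lemma gauss_cos_le a T w : 0 < a -> 0 < T -> 0 < w ->
  `|gauss_cos a T w| <= expR (- (w ^+ 2 / (4 * a))) * gauss_cos a T 0 +
                        2 / w * expR (- (a * T ^+ 2)).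
Proof.
move=> a0 T0 w0.
pose J s := \int[mu]_(t in `[0, T]) (t * expR (- (a * t ^+ 2)) * sin (s * t)).
pose h s := expR (s ^+ 2 / (4 * a)) * gauss_cos a T s.
pose dh s := expR (s ^+ 2 / (4 * a)) * (expR (- (a * T ^+ 2)) * sin (s * T)) / (2 * a).
(* [dk] majorizes [|dh|] because [s ^+ 2 <= w * s] on [[0, w]] and [|sin| <= 1]; its exponent is
   linear in [s], so its primitive [k] is explicit. *)
pose k s := 2 / w * expR (- (a * T ^+ 2)) * expR (w * s / (4 * a)).
pose dk s := expR (- (a * T ^+ 2)) / (2 * a) * expR (w * s / (4 * a)).
have dhP (s : R) : is_derive s 1 h (dh s).
  have dg : is_derive s 1 (gauss_cos a T) (- J s).
    by apply: is_derive_gauss_cos; exact: ltW.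
  apply: is_derive_eq; rewrite /= ?scaler0 ?addr0 ?add0r /GRing.scale /= /dh.
  have -> : J s = (s * gauss_cos a T s - expR (- (a * T ^+ 2)) * sin (s * T)) / (2 * a).
    by rewrite -gauss_cos_by_parts// -/(J s); field; lra.
  field; lra.
have dkP (s : R) : is_derive s 1 k (dk s).
  apply: is_derive_eq; rewrite /= ?scaler0 ?addr0 ?add0r /GRing.scale /= /dk.
  field; lra.
have := normB_le_derive (ltW w0) dhP dkP.
have hk t : 0 <= t <= w -> `|dh t| <= dk t.
  move=> /andP[t0 tw]; rewrite /dh /dk normf_div !normrM.
  rewrite !(gtr0_norm (expR_gt0 _)) (@ger0_norm _ (2 : R))// (gtr0_norm a0).
  rewrite mulrAC [leLHS]mulrC -!mulrA ler_pM2l ?expR_gt0//.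
  rewrite [leRHS]mulrC [leLHS]mulrA ler_pM2r ?invr_gt0; last lra.
  apply: (le_trans (y := expR (t * (t / (4 * a))))).
    by rewrite ler_piMl ?expR_ge0// ler_norml sin_geN1 sin_le1.
  by rewrite ler_expR ler_wpM2r// divr_ge0//; lra.
move=> /(_ hk) {hk}.
rewrite {2}/h expr0n /= mul0r expR0 mul1r => hb.
have e0 : 0 < expR (w ^+ 2 / (4 * a)) by exact: expR_gt0.
rewrite -(ler_pM2l e0).
rewrite mulrDr mulrA -expRD subrr expR0 mul1r.
rewrite -[X in X * `|_|](gtr0_norm e0) -normrM -/(h w).
have kw : k w = expR (w ^+ 2 / (4 * a)) * (2 / w * expR (- (a * T ^+ 2))).
  by rewrite /k -expr2 mulrC.
have k0 : 0 <= k 0 by rewrite !mulr_ge0 ?expR_ge0 ?invr_ge0// ltW.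
rewrite -kw.
have := ler_normB (h w - gauss_cos a T 0) (- gauss_cos a T 0).
rewrite opprK subrK normrN (ger0_norm (gauss_cos_ge0 _ _)).
lra.
Qed.

Lemma gauss_cos0_lb a T tau : 0 <= a -> 0 <= tau <= T ->
  tau * expR (- (a * tau ^+ 2)) <= gauss_cos a T 0.
Proof.
move=> a0 /andP[tau0 tauT].
have intg b := continuous_integrable_itv 0 b (@continuous_gauss_cos a 0).
have := @Rintegral_itvB _ _ (BLeft 0) (BRight T) tau (intg T).
rewrite !bnd_simp => /(_ tau0 tauT).
rewrite -/(gauss_cos a T 0) -/(gauss_cos a tau 0) => gT.
have : 0 <= gauss_cos a T 0 - gauss_cos a tau 0.
  by rewrite gT; apply: Rintegral_ge0 => t _; rewrite mul0r cos0 mulr1 expR_ge0.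
rewrite subr_ge0; apply: le_trans.
have -> : tau * expR (- (a * tau ^+ 2)) =
    \int[mu]_(t in `[0, tau]) (cst (expR (- (a * tau ^+ 2))) t).
  rewrite Rintegral_cst//= lebesgue_measure_itv /= lte_fin; case: ltP => /= h.
    by rewrite subr0 mulrC.
  by have /eqP -> : tau == 0; [lra|rewrite mul0r mulr0].
apply: le_Rintegral => //; first by apply: continuous_integrable_itv => x; exact: cvg_cst.
move=> t /=; rewrite in_itv /= => /andP[t0 tt]; rewrite mul0r cos0 mulr1 ler_expR.
by rewrite lerN2 ler_wpM2l// lerXn2r// nnegrE.
Qed.

Lemma gauss_average_sum (n : nat) (c w : 'I_n -> R) a T :
  (\sum_i c i) * gauss_cos a T 0 =
  \int[mu]_(t in `[0, T])
     (expR (- (a * t ^+ 2)) * \sum_i c i * (1 - cos (w i * t))) +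
  \sum_i c i * gauss_cos a T (w i).
Proof.
have cont i : continuous (fun t : R =>
    expR (- (a * t ^+ 2)) * cos (0 * t) - expR (- (a * t ^+ 2)) * cos (w i * t)).
  by move=> t; apply: cvgB; exact: continuous_gauss_cos.
rewrite [X in X + _](_ : _ = \int[mu]_(t in `[0, T])
    \sum_i c i * (expR (- (a * t ^+ 2)) * cos (0 * t) -
      expR (- (a * t ^+ 2)) * cos (w i * t))); last first.
  apply: eq_Rintegral => t _; rewrite mulr_sumr; apply: eq_bigr => i _.
  by rewrite mul0r cos0; ring.
rewrite Rintegral_bigsum; last first.
  by move=> i t; apply: cvgM; [exact: cvg_cst|exact: cont].
rewrite mulr_suml -big_split /=; apply: eq_bigr => i _.
rewrite RintegralZl//; last exact/continuous_integrable_itv/cont.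
rewrite RintegralB//; [|apply: continuous_integrable_itv; exact: continuous_gauss_cos..].
by rewrite -/(gauss_cos a T 0) -/(gauss_cos a T (w i)); ring.
Qed.

(** The sum is the primitive of the sine sum that vanishes at 0, so the primitive of the bound
    dominates it. The gained [1 / d.+2] later offsets one factor [d] of [T ^+ 2]. *)
Lemma norm_sum_1Bcos_le (n d : nat) (x w : 'I_n -> R) (K T : R) t :
  0 < T -> 0 <= t <= T -> (forall i, w i != 0) ->
  (forall s : R, 0 <= s <= T -> `|\sum_i x i * sin (w i * s)| <= K * (s / T) ^+ d.+1) ->
  `|\sum_i x i / w i * (1 - cos (w i * t))| <= K * T / d.+2%:R * (t / T) ^+ d.+2.
Proof.
move=> T0 /andP[t0 tT] w0 xsin.
pose P s := \sum_i x i / w i * (1 - cos (w i * s)).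
pose g s := K * T / d.+2%:R * (s / T) ^+ d.+2.
have dP (s : R) : is_derive s 1 P (\sum_i x i * sin (w i * s)).
  have -> : P = \sum_i (fun s => x i / w i * (1 - cos (w i * s))).
    by apply/funext => u; rewrite fct_sumE.
  apply: is_derive_sum => i; apply: is_derive_eq.
  rewrite /= ?scaler0 ?addr0 ?add0r /GRing.scale /=; field; exact: w0.
have dg (s : R) : is_derive s 1 g (K * (s / T) ^+ d.+1).
  have -> : g = (K * T / d.+2%:R) \*: ((fun u : R => u / T) ^+ d.+2).
    by apply/funext => u; rewrite /g /= exprfctE.
  have dl : is_derive s 1 (fun u : R => u / T) T^-1.
    by apply: is_derive_eq; rewrite /= ?scaler0 ?addr0 ?add0r /GRing.scale /= mulr1.
  apply: is_derive_eq; rewrite /GRing.scale /=.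
  have : d.+2%:R != 0 :> R by rewrite pnatr_eq0.
  by move: (d.+2%:R : R) ((s / T) ^+ d.+1) => N p N0; field; rewrite N0; lra.
have := normB_le_derive t0 dP dg; rewrite /g mul0r expr0n mulr0 subr0.
rewrite [P 0]big1 ?subr0; last by move=> i _; rewrite mulr0 cos0 subrr mulr0.
by apply=> s /andP[s0 st]; apply: xsin; rewrite s0 (le_trans st).
Qed.

(** The three conditions on the rate [th] control, in order, the Gaussian tail at frequencies at
    least [Delta], the cutoff at [T], and the Lieb-Robinson term per unit of distance. *)
Lemma norm_sum_div_le (Delta v y th K : R) (d n : nat) (x w : 'I_n -> R) :
  0 < Delta -> 0 < v -> 0 < y -> 0 <= K -> (0 < d)%N ->
  th <= Delta ^+ 2 / (2 * y * v ^+ 2) -> th <= y / 2 ->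
  (forall s : R, 0 <= s <= 1 -> s * expR (- (y * s ^+ 2 / 2)) <= expR (- th)) ->
  (forall i, Delta <= w i) -> \sum_i `|x i| <= 1 ->
  (forall t, 0 <= t -> v * t <= d%:R ->
     `|\sum_i x i * sin (w i * t)| <= K * (v * t / d%:R) ^+ d.+1) ->
  `|\sum_i x i / w i| <=
  (Delta^-1 + 2 * v * expR (y / 2) / Delta ^+ 2 + K * expR (y / 2) / v) *
  Num.sqrt d%:R * expR (- (d%:R * th)).
Proof.
move=> D0 v0 y0 K0 d0 th1 th2 th3 wD x1 xsin.
have q0 : 0 < d%:R :> R by rewrite ltr0n.
set q := d%:R; rewrite -/q in q0.
have q1 : 1 <= q by rewrite /q ler1n.
set r := Num.sqrt q.
have rq : r ^+ 2 = q by rewrite sqr_sqrtr// ltW.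
have r1 : 1 <= r by rewrite -sqrtr1 ler_sqrt// ltW.
have r0 : 0 < r := lt_le_trans ltr01 r1.
(* This scaling gives [a * T ^+ 2 = q * y / 2] and [Delta ^+ 2 / (4 * a) = q * Delta ^+ 2 / (2 * y *
   v ^+ 2)]: both exponents are linear in the distance. *)
pose T := q / v; pose a := y * v ^+ 2 / (2 * q).
have T0 : 0 < T by rewrite divr_gt0.
have a0 : 0 < a by rewrite divr_gt0 ?mulr_gt0 ?exprn_gt0.
have w0 i : 0 < w i by rewrite (lt_le_trans D0).
set e := expR (- (q * th)).
have e0 : 0 < e := expR_gt0 _.
set E := expR (y / 2); have E0 : 0 < E := expR_gt0 _.
set phi0 := gauss_cos a T 0.
(* At time [r / v] the Gaussian exponent is [y / 2], independent of [d], so the total weight is at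
   least of order [r]. *)
have phi_ge : r / v <= phi0 * E.
  rewrite -ler_pdivrMr// /E -expRN.
  have := @gauss_cos0_lb a T (r / v) (ltW a0); rewrite -/phi0.
  have -> : a * (r / v) ^+ 2 = y / 2.
    by rewrite exprMn rq /a; field; lra.
  apply; apply/andP; split; first by rewrite divr_ge0 ?ltW.
  by rewrite ler_pM2r ?invr_gt0// -rq expr2 ler_peMr// ltW.
have phi_gt0 : 0 < phi0.
  by rewrite -(pmulr_lgt0 _ E0) (lt_le_trans _ phi_ge)// divr_gt0.
have eT : expR (- (a * T ^+ 2)) <= e.
  rewrite ler_expR lerN2.
  have -> : a * T ^+ 2 = q * (y / 2) by rewrite /a /T; field; lra.
  by rewrite ler_pM2l.
have eD i : expR (- (w i ^+ 2 / (4 * a))) <= e.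
  rewrite ler_expR lerN2; apply: (le_trans (y := q * (Delta ^+ 2 / (2 * y * v ^+ 2)))).
    by rewrite ler_pM2l.
  have -> : q * (Delta ^+ 2 / (2 * y * v ^+ 2)) = Delta ^+ 2 / (4 * a).
    by rewrite /a; field; rewrite ?andbT; lra.
  rewrite ler_pM2r ?invr_gt0; last lra.
  by rewrite lerXn2r ?nnegrE ?(ltW D0) ?(ltW (w0 i)).
have xsinT s : 0 <= s <= T -> `|\sum_i x i * sin (w i * s)| <= K * (s / T) ^+ d.+1.
  move=> /andP[s0 sT]; have -> : s / T = v * s / q by rewrite /T; field; lra.
  by apply: xsin => //; rewrite mulrC -ler_pdivlMr.
have Pb t : 0 <= t <= T ->
    `|expR (- (a * t ^+ 2)) * \sum_i x i / w i * (1 - cos (w i * t))| <=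
    K * T / d.+2%:R * e.
  move=> tT; rewrite normrM (gtr0_norm (expR_gt0 _)).
  have wn0 i : w i != 0 by rewrite gt_eqF.
  apply: (le_trans (ler_wpM2l (expR_ge0 _) (norm_sum_1Bcos_le T0 tT wn0 xsinT))).
  rewrite mulrCA; apply: ler_wpM2l; first by rewrite divr_ge0// mulr_ge0// ltW.
  case/andP: tT => t0 tT.
  have s0 : 0 <= t / T by rewrite divr_ge0// ltW.
  have s1 : t / T <= 1 by rewrite ler_pdivrMr// mul1r.
  have -> : a * t ^+ 2 = q * (y * (t / T) ^+ 2 / 2) by rewrite /a /T; field; lra.
  move: (t / T) s0 s1 => s s0 s1.
  (* Of the [d.+2] factors [s], [d] are paired with the Gaussian so that [th3] applies to each pair;
     the other two are at most 1. *)
  apply: (le_trans (y := (s * expR (- (y * s ^+ 2 / 2))) ^+ d)).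
    rewrite exprMn -expRM_natl mulrN mulrC ler_wpM2r ?expR_ge0//.
    by rewrite -addn2 exprD ler_piMr ?exprn_ge0 ?exprn_ile1.
  have -> : e = expR (- th) ^+ d by rewrite /e /q -mulrN expRM_natl.
  rewrite lerXn2r ?nnegrE ?mulr_ge0 ?expR_ge0//.
  by apply: th3; rewrite s0.
have avg := gauss_average_sum (fun i => x i / w i) w a T.
rewrite -/phi0 in avg.
have cP : continuous (fun t : R =>
    expR (- (a * t ^+ 2)) * \sum_i x i / w i * (1 - cos (w i * t))).
  move=> t; apply: cvgM.
    by apply: (is_derive_continuous (f := fun t : R => expR (- (a * t ^+ 2)))).
  apply: cvg_big => //; first exact: add_continuous.
  move=> i _.
  by apply: (is_derive_continuous (f := fun t : R => x i / w i * (1 - cos (w i * t)))).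
have int_le : `|\int[mu]_(t in `[0, T])
    (expR (- (a * t ^+ 2)) * \sum_i x i / w i * (1 - cos (w i * t)))| <=
    K * T / d.+2%:R * e * T.
  apply: (le_trans (le_normr_Rintegral _ _)) => //.
    apply: continuous_integrable_itv; exact: cP.
  rewrite (_ : _ * T = \int[mu]_(t in `[0, T]) cst (K * T / d.+2%:R * e) t); last first.
    by rewrite Rintegral_cst//= lebesgue_measure_itv /= lte_fin T0 /= subr0.
  apply: le_Rintegral => //.
  - apply: continuous_integrable_itv => t; apply: continuous_comp (cP t) _.
    exact: norm_continuous.
  - by apply: continuous_integrable_itv => t; exact: cvg_cst.
have sum_le : `|\sum_i x i / w i * gauss_cos a T (w i)| <=
    Delta^-1 * (e * phi0 + 2 / Delta * e).
  apply: (le_trans (ler_norm_sum _ _ _)).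
  apply: (le_trans (y := \sum_i `|x i| * (Delta^-1 * (e * phi0 + 2 / Delta * e)))).
    apply: ler_sum => i _; rewrite normrM normf_div -[leLHS]mulrA; apply: ler_wpM2l => //.
    rewrite (gtr0_norm (w0 i)) ler_pM ?invr_ge0 ?(ltW (w0 i))// ?lef_pV2 ?posrE//.
    apply: (le_trans (gauss_cos_le a0 T0 (w0 i))).
    apply: lerD; first by rewrite ler_pM2r.
    apply: ler_pM => //; rewrite ?expR_ge0 ?divr_ge0 ?(ltW (w0 i))//.
    by rewrite ler_pM2l// lef_pV2 ?posrE.
  rewrite -mulr_suml ler_piMl//; apply: mulr_ge0; first by rewrite invr_ge0 ltW.
  by apply: addr_ge0; apply: mulr_ge0; rewrite ?divr_ge0// ltW.
(* Multiplying the claim by the total weight turns its left-hand side into that of [avg]. *)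
rewrite -(ler_pM2r phi_gt0) -{1}(gtr0_norm phi_gt0) -normrM avg.
apply: (le_trans (ler_normD _ _)); apply: (le_trans (lerD int_le sum_le)).
(* [T ^+ 2 / d.+2] is at most [(r / v) ^+ 2]; the weight [phi0] absorbs one factor [r / v], leaving
   a single square root of [d]. *)
have h1 : K * T / d.+2%:R * e * T <= K * E / v * r * e * phi0.
  apply: (le_trans (y := K * e * (q / v ^+ 2))).
    rewrite [leLHS](_ : _ = K * e * (T ^+ 2 / d.+2%:R)); last by ring.
    rewrite ler_wpM2l ?mulr_ge0 ?(ltW e0)//.
    rewrite ler_pdivrMr ?ltr0n// /T expr_div_n [leRHS]mulrAC.
    rewrite ler_pM2r ?invr_gt0 ?exprn_gt0//.
    by rewrite expr2 ler_pM2l// /q ler_nat -addn2 leq_addr.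
  rewrite [leRHS](_ : _ = K * e * (r / v * (phi0 * E))); last by ring.
  rewrite ler_wpM2l ?mulr_ge0 ?(ltW e0)//.
  by rewrite -rq -expr_div_n expr2 ler_wpM2l// divr_ge0 ?(ltW r0) ?(ltW v0).
have h2 : e * phi0 <= r * e * phi0.
  by rewrite ler_pM2r// ler_peMl// ltW.
have h3 : e <= v * E * r * e * phi0.
  rewrite [leRHS](_ : _ = v * r * (phi0 * E) * e); last by ring.
  rewrite ler_peMl ?(ltW e0)//.
  apply: (le_trans (y := v * r * (r / v))).
    by rewrite [leRHS](_ : _ = r ^+ 2); [rewrite rq|field; lra].
  by rewrite ler_wpM2l// mulr_ge0// ltW.
have Dv : 0 < Delta^-1 by rewrite invr_gt0.
rewrite [leRHS](_ : _ = K * E / v * r * e * phi0 + (Delta^-1 * (r * e * phi0) +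
  2 * Delta^-1 ^+ 2 * (v * E * r * e * phi0))); last by rewrite exprVn; ring.
rewrite lerD// mulrDr lerD//; first by rewrite ler_pM2l.
rewrite [leLHS](_ : _ = 2 * Delta^-1 ^+ 2 * e); last by ring.
by rewrite ler_wpM2l// mulr_ge0// sqr_ge0.
Qed.

End gaussian_filter.

(** * The decay rate *)

Section decay_rate.
Local Open Scope classical_set_scope.
Variable R : realType.

Lemma lambertW_ge0 (X : R) : 0 <= X -> 0 <= lambertW X.
Proof.
move=> X0; apply: ub_le_sup; last by rewrite /= mul0r.
exists X => w /= [w0]; apply: le_trans.
by rewrite ler_peMr// -expR0 ler_expR.
Qed.

Lemma lambertW_le (X : R) : 0 <= X -> lambertW X * expR (lambertW X) <= X.
Proof.
move=> X0.
have mulexp_homo (u w : R) : 0 <= u -> u <= w -> u * expR u <= w * expR w.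
  by move=> u0 uw; rewrite ler_pM ?expR_ge0 ?ler_expR.
have mulexp_ge (u : R) : 0 <= u -> u <= u * expR u.
  by move=> u0; rewrite ler_peMr// -expR0 ler_expR.
(* The intermediate value theorem gives an exact solution [w]; strict growth of [u * expR u] makes
   it an upper bound of the set whose supremum is [lambertW X]. *)
have [w] : exists2 w : R, w \in `[0, X]%R & w * expR w = X.
  apply: (@IVT R (fun w : R => w * expR w)) => //.
    by apply/continuous_subspaceT/is_derive_continuous.
  rewrite mul0r min_l ?max_r ?mulr_ge0 ?expR_ge0//.
  by rewrite X0 mulexp_ge.
rewrite in_itv /= => /andP[w0 _] wX.
rewrite -{3}wX; apply: mulexp_homo; first exact: lambertW_ge0.
apply: ge_sup; first by exists 0; rewrite /= mul0r.
move=> u /= [u0]; rewrite -{1}wX => uX; rewrite leNgt; apply/negP => wu.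
move: uX; apply/negP; rewrite -ltNge.
by rewrite (le_lt_trans (y := w * expR u)) ?ler_wpM2l ?ler_expR ?ltr_pM2r ?expR_gt0// ltW.
Qed.

(* [y] fixes the width of the Gaussian filter, namely [a = y v^2 / 2d]. For
   [Delta <= v] it is [Delta / v]; otherwise [y = e^(W - 1)] is where the three
   exponents balance. *)
Lemma xi_inv_filter_width (Delta v : R) : 0 < Delta -> 0 < v ->
  exists y : R, [/\ 0 < y, xi_inv Delta v <= Delta ^+ 2 / (2 * y * v ^+ 2),
    xi_inv Delta v <= y / 2 &
    forall s : R, 0 <= s <= 1 -> s * expR (- (y * s ^+ 2 / 2)) <= expR (- xi_inv Delta v)].
Proof.
move=> D0 v0; rewrite /xi_inv; case: ifPn => [Dv|].
  exists (Delta / v); have y0 : 0 < Delta / v by rewrite divr_gt0.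
  have y1 : Delta / v <= 1 by rewrite ler_pdivrMr// mul1r.
  have xiE : Delta / (2 * v) = Delta / v / 2 by field; lra.
  split=> //.
  - by rewrite [leRHS](_ : _ = Delta / (2 * v))//; field; lra.
  - by rewrite xiE.
  - move=> s /andP[s0 s1]; rewrite xiE.
    rewrite -ler_pdivlMr ?expR_gt0// -expRN -expRD.
    (* The square root of this inequality reduces the claim to
       [(1 - s ^+ 2) * (1 - Delta / v) >= 0], where [Delta <= v] enters. *)
    have ss : s ^+ 2 <= expR (s ^+ 2 - 1).
      by apply: le_trans (expR_ge1Dx _); lra.
    have : s <= expR ((s ^+ 2 - 1) / 2).
      rewrite -(@ler_pXn2r _ 2) ?nnegrE ?expR_ge0// -expRM_natl.
      by apply: (le_trans ss); rewrite ler_expR; lra.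
    move=> /le_trans; apply; rewrite ler_expR.
    have s21 : 0 <= 1 - s ^+ 2 by rewrite subr_ge0 expr_le1.
    have z1 : 0 <= 1 - Delta / v by rewrite subr_ge0.
    by have := mulr_ge0 s21 z1; lra.
rewrite -ltNge => vD.
set X := _ / v ^+ 2; set W := lambertW X.
have X0 : 0 <= X by rewrite divr_ge0 ?sqr_ge0// mulr_ge0 ?sqr_ge0 ?expR_ge0.
have WX := lambertW_le X0; rewrite -/W in WX.
exists (expR (W - 1)); have y0 := expR_gt0 (W - 1).
have yE : expR (W - 1) * expR 1 = expR W by rewrite -expRD subrK.
split=> //.
- rewrite ler_pdivlMr ?mulr_gt0// ?exprn_gt0//.
  (* Since [expR W] is [expR 1] times the chosen width, the factor [expR 1] in [X] cancels. *)
  have : W * expR W * v ^+ 2 <= Delta ^+ 2 * expR 1.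
    by rewrite -ler_pdivlMr ?exprn_gt0.
  rewrite -yE [leLHS](_ : _ = W * expR (W - 1) * v ^+ 2 * expR 1); last by ring.
  rewrite ler_pM2r ?expR_gt0//.
  by apply: le_trans; rewrite [leLHS](_ : _ = W * expR (W - 1) * v ^+ 2)//; field.
- by rewrite ler_pM2r ?invr_gt0//; apply: le_trans (expR_ge1Dx _); lra.
- move=> s /andP[s0 s1].
  rewrite -(@ler_pXn2r _ 2) ?nnegrE ?mulr_ge0 ?expR_ge0// exprMn -!expRM_natl.
  set u := expR (W - 1) * s ^+ 2.
  have -> : 2 * - (u / 2) = - u by lra.
  have -> : 2 * - (W / 2) = - W by lra.
  (* Equivalently [u * expR (- u) <= expR (- 1)], an equality at [u = 1]; [yE] converts it into the
     squared claim. *)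
  have : u <= expR (u - 1) by apply: le_trans (expR_ge1Dx _); lra.
  rewrite expRB ler_pdivlMr ?expR_gt0// /u mulrAC yE -/u => h.
  by rewrite !expRN ler_pdivrMr ?expR_gt0// mulrC ler_pdivlMr ?expR_gt0// mulrC.
Qed.

End decay_rate.

(** * Matrix elements in the energy eigenbasis *)

Section matrix_elements.
Local Open Scope classical_set_scope.
Local Open Scope complex_scope.
Variable R : realType.
Notation C := R[i].

Definition normc2 (z : C) : R := complex.Re z ^+ 2 + complex.Im z ^+ 2.

Lemma normc2_ge0 z : 0 <= normc2 z.
Proof. by rewrite addr_ge0 ?sqr_ge0. Qed.

Lemma normc2_conj z : normc2 (conjc z) = normc2 z.
Proof. by case: z => x y; rewrite /normc2 /= sqrrN. Qed.

Lemma normc2E z : conjc z * z = (normc2 z)%:C.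
Proof. by case: z => x y; rewrite /normc2 /=; simpc; congr (_ +i* _); ring. Qed.

Lemma sqr_cabs z : cabs z ^+ 2 = normc2 z.
Proof. by rewrite sqr_sqrtr ?normc2_ge0. Qed.

Lemma cabs_ge0 (z : C) : 0 <= cabs z.
Proof. exact: sqrtr_ge0. Qed.

Lemma norm_Im_le_cabs (z : C) : `|complex.Im z| <= cabs z.
Proof. by rewrite -sqrtr_sqr ler_wsqrtr// lerDr sqr_ge0. Qed.

Lemma norm_Re_mul_le (z w : C) : `|complex.Re (z * w)| <= (normc2 z + normc2 w) / 2.
Proof.
case: z w => [a b] [c d]; rewrite /normc2 /=; simpc => /=.
have := (sqr_ge0 (a - c), sqr_ge0 (a + c), sqr_ge0 (b - d), sqr_ge0 (b + d)).
by move=> [[[]]] ? ? ? ?; rewrite ler_norml; apply/andP; split; lra.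
Qed.

Lemma sqr_vnorm n (x : 'cV[C]_n) : vnorm x ^+ 2 = \sum_i normc2 (x i 0).
Proof. by rewrite sqr_sqrtr// sumr_ge0// => i _; exact: normc2_ge0. Qed.

Lemma vnorm_ge0 n (x : 'cV[C]_n) : 0 <= vnorm x.
Proof. exact: sqrtr_ge0. Qed.

Lemma mxadjM m n p (A : 'M[C]_(m, n)) (B : 'M[C]_(n, p)) :
  mxadj (A *m B) = mxadj B *m mxadj A.
Proof. by rewrite /mxadj map_mxM trmx_mul. Qed.

Lemma mxadjK m n (A : 'M[C]_(m, n)) : mxadj (mxadj A) = A.
Proof. by apply/matrixP => i j; rewrite !mxE conjcK. Qed.

Lemma mxadj_mul_self n (x : 'cV[C]_n) : (mxadj x *m x) 0 0 = (vnorm x ^+ 2)%:C.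
Proof.
rewrite sqr_vnorm mxE rmorph_sum /=; apply: eq_bigr => i _.
by rewrite !mxE normc2E.
Qed.

Lemma unitary_mxadj n (U : 'M[C]_n) : unitary_mx U -> mxadj U *m U = 1%:M.
Proof. exact: mulmx1C. Qed.

Lemma vnorm_unitary n (U : 'M[C]_n) (x : 'cV[C]_n) :
  unitary_mx U -> vnorm (mxadj U *m x) = vnorm x.
Proof.
move=> UU; apply/eqP; rewrite -(@eqrXn2 _ 2) ?vnorm_ge0//; apply/eqP.
apply: (fmorph_inj (real_complex R)) => /=.
rewrite -!mxadj_mul_self mxadjM mxadjK -mulmxA (mulmxA U) UU mul1mx//.
Qed.

Lemma vnorm_col_unitary n (U : 'M[C]_n) k : unitary_mx U -> vnorm (col k U) = 1.
Proof.
move=> /unitary_mxadj UU; apply/eqP; rewrite -(@eqrXn2 _ 2) ?vnorm_ge0// expr1n.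
rewrite sqr_vnorm; apply/eqP; apply: (fmorph_inj (real_complex R)) => /=.
have /matrixP/(_ k k) := UU; rewrite !mxE eqxx mulr1n => UU1; rewrite -[RHS]/(1 : C) -UU1.
by rewrite rmorph_sum /=; apply: eq_bigr => i _; rewrite !mxE normc2E.
Qed.

Lemma cabs_sum_le (I : finType) (f : I -> C) : cabs (\sum_i f i) <= \sum_i cabs (f i).
Proof.
have h z : (cabs z)%:C = `|z| :> C by rewrite normc_def.
rewrite -lecR h rmorph_sum; apply: (le_trans (ler_norm_sum _ _ _)).
by apply: ler_sum => i _; rewrite -h.
Qed.

Lemma cabsM (z w : C) : cabs (z * w) = cabs z * cabs w.
Proof. by have := @ComplexField.Normc.normcM R z w; case: z w => [? ?] [? ?]. Qed.

Lemma cabs_le_vnorm n (x : 'cV[C]_n) i : cabs (x i 0) <= vnorm x.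
Proof.
rewrite ler_wsqrtr// (bigD1 i)//= lerDl sumr_ge0// => j _; exact: normc2_ge0.
Qed.

(** [sup] is informative only on a bounded set. Entries of a vector in the unit ball are at most 1,
    so the absolute row sums of [M] supply a bound. *)
Lemma vnorm_le_opnorm n (M : 'M[C]_n) (x : 'cV[C]_n) :
  vnorm x <= 1 -> vnorm (M *m x) <= opnorm M.
Proof.
move=> x1; apply: ub_le_sup; last by exists x.
exists (Num.sqrt (\sum_i (\sum_j cabs (M i j)) ^+ 2)) => _ [y [y1 ->]].
apply: ler_wsqrtr; apply: ler_sum => i _.
rewrite -[leLHS]/(normc2 _) -sqr_cabs lerXn2r ?nnegrE ?cabs_ge0//.
  by apply: sumr_ge0 => j _; exact: cabs_ge0.
rewrite mxE; apply: (le_trans (cabs_sum_le _)); apply: ler_sum => j _.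
by rewrite cabsM ler_piMr ?cabs_ge0// (le_trans (cabs_le_vnorm _ _)).
Qed.

(** Parseval: the column is [mxadj U] applied to [M *m col k U], [mxadj U] preserves norms, and
    [col k U] is a unit vector. *)
Lemma sum_normc2_col_le n (U M : 'M[C]_n) k : unitary_mx U ->
  \sum_i normc2 ((mxadj U *m M *m U) i k) <= opnorm M ^+ 2.
Proof.
move=> UU; apply: (le_trans (y := vnorm (M *m col k U) ^+ 2)).
  rewrite -(vnorm_unitary _ UU) sqr_vnorm; apply: ler_sum => i _.
  rewrite mulmxA [X in normc2 X](_ : _ = (mxadj U *m M *m col k U) i 0)//.
  by rewrite [LHS]mxE [RHS]mxE; apply: eq_bigr => j _; rewrite [col _ _ _ _]mxE.
rewrite lerXn2r ?nnegrE ?vnorm_ge0//.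
  apply: (le_trans (vnorm_ge0 (M *m (col k U)))).
  by rewrite vnorm_le_opnorm ?vnorm_col_unitary.
by rewrite vnorm_le_opnorm ?vnorm_col_unitary.
Qed.

Lemma expect_col n (U M : 'M[C]_n) k :
  expect (col k U) M = (mxadj U *m M *m U) k k.
Proof.
rewrite /expect; have -> : mxadj (col k U) = row k (mxadj U).
  by apply/matrixP => i j; rewrite !mxE.
by rewrite -row_mul !mxE; apply: eq_bigr => i _; rewrite !mxE.
Qed.

Lemma mulmx_diag_entry n (A B : 'M[C]_n) (g : 'I_n -> C) i j :
  (A *m diag_mx (\row_k g k) *m B) i j = \sum_k A i k * g k * B k j.
Proof. by rewrite mxE; apply: eq_bigr => k _; rewrite mul_mx_diag !mxE. Qed.

Lemma hermitian_conj_mx n (U A : 'M[C]_n) : hermitian_mx A ->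
  hermitian_mx (mxadj U *m A *m U).
Proof. by rewrite /hermitian_mx !mxadjM mxadjK => ->; rewrite mulmxA. Qed.

Lemma hermitian_entry n (A : 'M[C]_n) i j : hermitian_mx A -> A i j = conjc (A j i).
Proof. by move=> {1}<-; rewrite !mxE. Qed.

Lemma conjcM (z w : C) : conjc (z * w) = conjc z * conjc w.
Proof. exact: rmorphM. Qed.

Lemma cexpiN (th : R) : cexpi (- th) = conjc (cexpi th).
Proof. by rewrite /cexpi cosN sinN. Qed.

Lemma cexpiD (th ph : R) : cexpi (th + ph) = cexpi th * cexpi ph.
Proof. by rewrite /cexpi cosD sinD; simpc; congr (_ +i* _); ring. Qed.

Section ground_state.
Variables (n : nat) (U A B : 'M[C]_n.+1) (E : 'I_n.+1 -> R).
Hypothesis unitU : unitary_mx U.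
Hypotheses (hA : hermitian_mx A) (hB : hermitian_mx B).

Let A' := mxadj U *m A *m U.
Let B' := mxadj U *m B *m U.
Let c k := A' ord0 k * B' k ord0.

Lemma expect_fcalc (g : 'I_n.+1 -> C) :
  expect (col ord0 U) (A *m fcalc U g *m B) = \sum_k c k * g k.
Proof.
rewrite expect_col.
have -> : mxadj U *m (A *m fcalc U g *m B) *m U = A' *m diag_mx (\row_k g k) *m B'.
  by rewrite /A' /B' /fcalc !mulmxA.
by rewrite mulmx_diag_entry; apply: eq_bigr => k _; rewrite mulrAC.
Qed.

Lemma expect_heis_mul t : expect (col ord0 U) (heis U E t A *m B) =
  \sum_k c k * cexpi (- ((E k - E ord0) * t)).
Proof.
rewrite expect_col.
have -> : mxadj U *m (heis U E t A *m B) *m U =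
    diag_mx (\row_k cexpi (E k * t)) *m A' *m diag_mx (\row_k cexpi (- (E k * t))) *m B'.
  by rewrite /A' /B' /heis /fcalc !mulmxA (unitary_mxadj unitU) mul1mx.
rewrite mulmx_diag_entry; apply: eq_bigr => k _; rewrite mul_diag_mx !mxE.
have -> : - ((E k - E ord0) * t) = E ord0 * t + - (E k * t) by ring.
by rewrite cexpiD /c /A' /B' !mxE; ring.
Qed.

(** Hermiticity of [A] and [B] conjugates each term of [expect_heis_mul], so the expectation of the
    commutator is purely imaginary. *)
Lemma expect_mul_heis t : expect (col ord0 U) (B *m heis U E t A) =
  conjc (\sum_k c k * cexpi (- ((E k - E ord0) * t))).
Proof.
rewrite expect_col.
have -> : mxadj U *m (B *m heis U E t A) *m U =
    B' *m diag_mx (\row_k cexpi (E k * t)) *m (A' *m diag_mx (\row_k cexpi (- (E k * t)))).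
  by rewrite /A' /B' /heis /fcalc !mulmxA -(mulmxA _ _ U) (unitary_mxadj unitU) mulmx1.
rewrite mulmx_diag_entry rmorph_sum; apply: eq_bigr => k _.
rewrite -[RHS]/(conjc (A' ord0 k * B' k ord0 * cexpi (- ((E k - E ord0) * t)))) !conjcM.
rewrite -cexpiN opprK mul_mx_diag [X in _ * X]mxE [(\row__ _) _ _]mxE.
have -> : (E k - E ord0) * t = E k * t + - (E ord0 * t) by ring.
rewrite cexpiD (hermitian_entry ord0 k (hermitian_conj_mx U hB)) -/B'.
by rewrite (hermitian_entry k ord0 (hermitian_conj_mx U hA)) -/A'; ring.
Qed.
End ground_state.

Lemma opnorm_ge0 n (M : 'M[C]_n) : 0 <= opnorm M.
Proof.
have v0 : vnorm (0 : 'cV[C]_n) = 0.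
  by rewrite /vnorm big1 ?sqrtr0// => i _; rewrite mxE /= expr0n addr0.
by rewrite -v0 -(mulmx0 1 M) vnorm_le_opnorm// v0.
Qed.

Lemma cabs_expect_le_opnorm n (U M : 'M[C]_n) k : unitary_mx U ->
  cabs (expect (col k U) M) <= opnorm M.
Proof.
move=> UU; rewrite -(@ler_pXn2r _ 2) ?nnegrE ?cabs_ge0 ?opnorm_ge0//.
rewrite sqr_cabs expect_col; apply: le_trans (sum_normc2_col_le M k UU).
by rewrite (bigD1 k)//= lerDl sumr_ge0// => i _; exact: normc2_ge0.
Qed.

Lemma Re_sum (I : finType) (f : I -> C) :
  complex.Re (\sum_i f i) = \sum_i complex.Re (f i).
Proof. by apply: (big_morph (@complex.Re R)) => // -[? ?] [? ?]. Qed.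

Lemma Im_sum (I : finType) (f : I -> C) :
  complex.Im (\sum_i f i) = \sum_i complex.Im (f i).
Proof. by apply: (big_morph (@complex.Im R)) => // -[? ?] [? ?]. Qed.

(** Meant for [p] and [q] the imaginary parts at times [-t] and [t]; one factor 2 in the 4 comes
    from the commutator, the other from antisymmetrizing. *)
Lemma norm_half_diff_le (b p q s : R) :
  `|p| <= b -> `|q| <= b -> 4 * s = p - q -> `|s| <= b / 2.
Proof.
by rewrite !ler_norml => /andP[? ?] /andP[? ?] ?; apply/andP; split; lra.
Qed.

Section spectral_weights.
Variables (n : nat) (U A B : 'M[C]_n.+1) (E : 'I_n.+1 -> R).
Hypothesis unitU : unitary_mx U.
Hypotheses (hA : hermitian_mx A) (hB : hermitian_mx B).

Definition spectral_weight k : R := complex.Re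
  ((mxadj U *m A *m U) ord0 k * (mxadj U *m B *m U) k ord0).

(** Adding the complex conjugate leaves twice the real part; the absolute value absorbs the sign of
    [E ord0 - E k]. *)
Lemma cabs_fXY : cabs (fXY U E A B) =
  2 * `|\sum_(k | k != ord0) spectral_weight k / (E k - E ord0)|.
Proof.
rewrite /fXY /red_resolvent expect_fcalc; set z := \sum_k _.
have -> : cabs (z + conjc z) = 2 * `|complex.Re z|.
  case: z => x y; rewrite /cabs /=.
  have -> : x + x = 2 * x by ring.
  by rewrite subrr expr0n addr0 sqrtr_sqr normrM ger0_norm.
congr (_ * _); rewrite /z Re_sum (bigD1 ord0)//= mulr0 add0r -normrN -sumrN.
congr (`| _ |); apply: eq_bigr => k k0; rewrite (negbTE k0) /spectral_weight.
case: ((mxadj U *m A *m U) ord0 k * _ k ord0) => x y; simpc => /=.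
by rewrite -[E ord0 - E k]opprB invrN mulrN opprK.
Qed.

(** By hermiticity row 0 of the conjugated [A] is the conjugate of its column 0, so [norm_Re_mul_le]
    reduces the sum to two column norms. *)
Lemma sum_norm_spectral_weight : opnorm A <= 1 -> opnorm B <= 1 ->
  \sum_k `|spectral_weight k| <= 1.
Proof.
move=> A1 B1.
have col_le (M : 'M[C]_n.+1) : opnorm M <= 1 ->
    \sum_k normc2 ((mxadj U *m M *m U) k ord0) <= 1.
  move=> M1; apply: (le_trans (sum_normc2_col_le M ord0 unitU)).
  by rewrite expr_le1 ?opnorm_ge0.
apply: (le_trans (y := \sum_k (normc2 ((mxadj U *m A *m U) k ord0) +
    normc2 ((mxadj U *m B *m U) k ord0)) / 2)).
  apply: ler_sum => k _; apply: (le_trans (norm_Re_mul_le _ _)).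
  by rewrite (hermitian_entry ord0 k (hermitian_conj_mx U hA)) normc2_conj.
rewrite -mulr_suml big_split /=; have := col_le _ A1; have := col_le _ B1; lra.
Qed.

Lemma Im_expect_commut t :
  complex.Im (expect (col ord0 U) (commut (heis U E t A) B)) =
  2 * \sum_k complex.Im ((mxadj U *m A *m U) ord0 k * (mxadj U *m B *m U) k ord0 *
                         cexpi (- ((E k - E ord0) * t))).
Proof.
have -> : expect (col ord0 U) (commut (heis U E t A) B) =
    expect (col ord0 U) (heis U E t A *m B) - expect (col ord0 U) (B *m heis U E t A).
  by rewrite /expect /commut mulmxBr mulmxBl mxE [X in _ + X]mxE.
rewrite expect_heis_mul// expect_mul_heis// -Im_sum.
by case: (\sum_k _) => x y /=; ring.
Qed.

(* Antisymmetrizing in [t] isolates the real parts of the spectral weights, the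
   only ones entering [fXY]. *)
Lemma sum_spectral_weight_sin t :
  4 * \sum_k spectral_weight k * sin ((E k - E ord0) * t) =
  complex.Im (expect (col ord0 U) (commut (heis U E (- t) A) B)) -
  complex.Im (expect (col ord0 U) (commut (heis U E t A) B)).
Proof.
have := congr2 (fun r s : R => r - s) (Im_expect_commut (- t)) (Im_expect_commut t).
move=> ->; rewrite -mulrBr -sumrB mulr_sumr [RHS]mulr_sumr.
apply: eq_bigr => k _.
rewrite mulrN opprK /spectral_weight cexpiN /cexpi.
case: ((mxadj U *m A *m U) ord0 k * _ k ord0) => x y; simpc => /=; ring.
Qed.

Lemma norm_sum_spectral_weight_sin t (b : R) :
  opnorm (commut (heis U E t A) B) <= b ->
  opnorm (commut (heis U E (- t) A) B) <= b ->
  `|\sum_k spectral_weight k * sin ((E k - E ord0) * t)| <= b / 2.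
Proof.
move=> bt bNt.
have Im_le s : opnorm (commut (heis U E s A) B) <= b ->
    `|complex.Im (expect (col ord0 U) (commut (heis U E s A) B))| <= b.
  apply: le_trans; apply: (le_trans (norm_Im_le_cabs _)).
  exact: cabs_expect_le_opnorm.
exact: (norm_half_diff_le (Im_le _ bNt) (Im_le _ bt) (sum_spectral_weight_sin t)).
Qed.

End spectral_weights.

End matrix_elements.

(** * Assembly of the bound, with a constant uniform in the system and the distance *)

Theorem theorem1 (R : realType) (CLR v Delta : R) :
  0 < CLR -> 0 < v -> 0 < Delta ->
  exists Cst : R,
  forall (n : nat) (H U : 'M[R[i]]_n.+1) (E : 'I_n.+1 -> R)
         (A B : 'M[R[i]]_n.+1) (d : nat),
    (* H = U diag(E) U^dagger, with unique ground state |G> = U e_0 of energy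
       E0 = E 0 and spectral gap Delta *)
    unitary_mx U ->
    H = fcalc U (fun k => (E k)%:C) ->
    (forall k : 'I_n.+1, k != ord0 -> E ord0 + Delta <= E k) ->
    (exists k : 'I_n.+1, k != ord0 /\ E k = E ord0 + Delta) ->
    (* normalized local observables *)
    hermitian_mx A -> hermitian_mx B ->
    opnorm A = 1 -> opnorm B = 1 ->
    (* supports at distance d >= 1 *)
    (0 < d)%N ->
    (* Lieb-Robinson bound with velocity v *)
    (forall t : R, v * `|t| <= d%:R ->
        opnorm (commut (heis U E t A) B) <= CLR * (v * `|t| / d%:R) ^+ d.+1) ->
    cabs (fXY U E A B) <= Cst * Num.sqrt (d%:R) * expR (- (d%:R * xi_inv Delta v)).
Proof.
move=> C0 v0 D0.
have [y [y0 xi1 xi2 xi3]] := xi_inv_filter_width D0 v0.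
(* The outer 2 comes from [cabs_fXY], and [CLR / 2] from [norm_sum_spectral_weight_sin]; [y] depends
   only on [Delta] and [v]. *)
exists (2 * (Delta^-1 + 2 * v * expR (y / 2) / Delta ^+ 2 +
             CLR / 2 * expR (y / 2) / v)).
move=> n H U E A B d UU _ gap _ hA hB A1 B1 d0 LR.
rewrite cabs_fXY -!(mulrA 2) ler_pM2l// !mulrA.
(* [norm_sum_div_le] requires every frequency to be at least [Delta], so the ground state index gets
   weight 0 and the dummy frequency [Delta]. *)
pose x k := if k == ord0 then 0 else spectral_weight U A B k.
pose w k := if k == ord0 then Delta else E k - E ord0.
have -> : \sum_(k | k != ord0) spectral_weight U A B k / (E k - E ord0) =
    \sum_k x k / w k.
  rewrite [RHS](bigD1 ord0)//= {1}/x eqxx mul0r add0r; apply: eq_bigr => k k0.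
  by rewrite /x /w (negbTE k0).
apply: norm_sum_div_le xi1 xi2 xi3 _ _ _ => //.
- by rewrite divr_ge0// ltW.
- move=> k; rewrite /w; case: eqVneq => // k0.
  by rewrite lerBrDl gap.
- have A1' : opnorm A <= 1 by rewrite A1.
  have B1' : opnorm B <= 1 by rewrite B1.
  apply: le_trans (sum_norm_spectral_weight UU hA A1' B1').
  by apply: ler_sum => k _; rewrite /x; case: eqP => // _; rewrite normr0.
- move=> t t0 td.
  (* The ground state term can be restored: its true frequency is 0, so its sine vanishes. *)
  have -> : \sum_k x k * sin (w k * t) =
      \sum_k spectral_weight U A B k * sin ((E k - E ord0) * t).
    apply: eq_bigr => k _; rewrite /x /w; case: eqP => // ->.
    by rewrite subrr !mul0r sin0 mulr0.
  rewrite mulrAC.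
  apply: norm_sum_spectral_weight_sin => //.
    by have := LR t; rewrite ger0_norm//; exact.
  by have := LR (- t); rewrite normrN ger0_norm//; exact.
Qed.
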